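(* Let $G=(V,E)$ be a finite loopless multigraph in which every edge $e$ is operating independently with probability $p(e)\in[0,1]$, let $K\subseteq V$ with $|K|\ge 2$, and let $(G^1,G^2,X)$ be a $K$-splitting of $(G,K)$. Then \[ R(G,K)=\mathbf{r}_0(G^1)^T\,\mathbf{M}_0^{-1}\,\mathbf{r}_0(G^2). \] (In particular the principal submatrix $\mathbf{M}_0$ is invertible.)
   Context: Labelled set partitions: for a finite set $X$ and a symbol $l\notin X$, a labelled set partition of $X$ is a collection $\pi=\{B_1\cup L_1,\dots,B_k\cup L_k\}$ where $\{B_1,\dots,B_k\}$ is a set partition of $X$ (non-empty, pairwise disjoint blocks with union $X$) and each $L_i\in\{\emptyset,\{l\}\}$; the block $B_i\cup L_i$ is labelled if $L_i=\{l\}$ and unlabelled otherwise. $\Pi_l(X)$ is the set of all of them, ordered by $\sigma\le\pi$ iff every block of $\sigma$ (as a set, including $l$ if present) is a subset of some block of $\pi$; this is a lattice, and $\pi\vee\sigma$ denotes the join (least upper bound). $m(\pi)=1$ if $\pi$ has exactly one labelled block and $m(\pi)=0$ otherwise. $\mu$ denotes the Möbius function of the poset $\Pi_l(X)$ ($\mu(x,x)=1$, $\sum_{x\le z\le y}\mu(x,z)=0$ for $x<y$, $\mu(x,y)=0$ if $x\not\le y$). Graphs and reliability: graphs are finite, may have parallel edges but no loops. A spanning subgraph of $G$ is $H=(V,F)$ with $F\subseteq E$; its probability is $\mathrm{Pr}(H)=\prod_{e\in F}p(e)\prod_{e\in E\setminus F}(1-p(e))$. For a graph $H$ and a set $K'$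 of its vertices, $M(H,K')=1$ if all vertices of $K'$ lie in one connected component of $H$, and $0$ otherwise; $R(H,K')=\sum_{H'}M(H',K')\mathrm{Pr}(H')$, the sum over all spanning subgraphs $H'$ of $H$. For a vertex subset $Y$ and a set partition $\rho$ of $Y$, the $\rho$-merging $H_\rho$ is obtained by identifying all vertices in each block of $\rho$ into one vertex (the block), deleting the edges with both endpoints in one block and keeping all other edges (parallel edges kept), each edge keeping its probability; $H_Y$ is the merging by the one-block partition $\{Y\}$. $K$-splitting: $(G^1,G^2,X)$ with $G^i=(V^i,E^i)$ subgraphs of $G$ (each edge of $E^i$ has its endpoints in $V^i$), $E^1\cup E^2=E$, $E^1\cap E^2=\emptyset$, $V^1\cup V^2=V$, $V^1\cap V^2=X$, and $K^i:=K\cap V^i\neq\emptyset$ for $i=1,2$. For $\pi=\{B_1\cup L_1,\dots,B_k\cup L_k\}\in\Pi_l(X)$, $G^i_\pi$ is the merging of $G^i$ by $\{B_1,\dots,B_k\}$ and $K^i_\pi=(K^i\setminus X)\cup\{B_j: L_j=\{l\}\text{ or }B_j\cap K^i\ne\emptyset\}$. Let $\pi_X\in\Pi_l(X)$ be the partition of $X$ into singletons $\{x\}$, labelled iff $x\in K$, and $\Pi_l(X,\pi_X)=\{\pi\in\Pi_l(X):\pi\ge\pi_X,\ \pi\text{ has at least one labelled block}\}$. For $\pi\in\Pi_l(X,\pi_X)$ let $\lambda(\pi)=\sum_{\sigma\in\Pi_l(X,\pi_X),\,\sigma\ge\pi}\mu(\pi,\sigma)m(\sigma)$, and $\Pi_l(X,\pi_X)_0=\{\pi\in\Pi_l(X,\pi_X):\lambda(\pi)\neq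 0\}$. Fix an ordering of $\Pi_l(X,\pi_X)$. $\mathbf{M}=(m(\pi\vee\sigma))_{\pi,\sigma\in\Pi_l(X,\pi_X)}$ and $\mathbf{r}(G^i)=(R(G^i_\pi,K^i_\pi))_{\pi\in\Pi_l(X,\pi_X)}$. A subscript $0$ on a matrix or vector indexed by $\Pi_l(X,\pi_X)$ denotes deletion of all rows and columns whose index is not in $\Pi_l(X,\pi_X)_0$. *)

(* Defs.v *)
From HB Require Import structures.
From mathcomp Require Import all_boot all_order all_algebra.

Set Implicit Arguments.
Unset Strict Implicit.
Unset Printing Implicit Defensive.

Import Order.TTheory GRing.Theory Num.Theory.
Local Open Scope ring_scope.

(* [n] bounds the length of the recursion; [#|T|] is always enough, and
   [mobiusE] below is the recursion without this bound. *)
Fixpoint mobius_rec (d : Order.disp_t) (T : finPOrderType d) (n : nat)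
    (x y : T) : int :=
  if n is n'.+1 then
    if x == y then 1 else - \sum_(z : T | (x <= z < y)%O) mobius_rec n' x z
  else 0.

Definition mobius (d : Order.disp_t) (T : finPOrderType d) (x y : T) : int :=
  mobius_rec #|T| x y.

Lemma mobius_rec_stable (d : Order.disp_t) (T : finPOrderType d) (n m : nat)
    (x y : T) :
  (#|[set z : T | (z < y)%O]| < n)%N -> (#|[set z : T | (z < y)%O]| < m)%N ->
  mobius_rec n x y = mobius_rec m x y.
Proof.
elim: n m y => [|n IHn] [|m] y //=; rewrite !ltnS => len lem.
case: eqP => // _; congr (- _); apply: eq_bigr => z /andP[_ zy].
have ltzy : (#|[set t : T | (t < z)%O]| < #|[set t : T | (t < y)%O]|)%N.
  apply/proper_card/properP; split.
    by apply/subsetP => t; rewrite !inE => tz; apply: lt_trans zy.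
  by exists z; rewrite !inE ?zy ?ltxx.
by apply: IHn; [apply: leq_trans ltzy len | apply: leq_trans ltzy lem].
Qed.

Lemma mobiusE (d : Order.disp_t) (T : finPOrderType d) (x y : T) :
  mobius x y =
    if x == y then 1 else - \sum_(z : T | (x <= z < y)%O) mobius x z.
Proof.
have ht (t : T) : (#|[set z : T | (z < t)%O]| < #|T|)%N.
  rewrite -cardsT; apply/proper_card/properP; split; first exact: subsetT.
  by exists t; rewrite !inE ?ltxx.
rewrite {1}/mobius (@mobius_rec_stable _ _ _ #|T|.+1) ?ltnS ?ht ?(ltnW (ht _)) //.
Qed.

Lemma mobius_refl (d : Order.disp_t) (T : finPOrderType d) (x : T) :
  mobius x x = 1.
Proof. by rewrite mobiusE eqxx. Qed.

Lemma mobius_sum (d : Order.disp_t) (T : finPOrderType d) (x y : T) :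
  (x < y)%O -> \sum_(z : T | (x <= z <= y)%O) mobius x z = 0.
Proof.
move=> xy; rewrite (bigD1 y) /=; last by rewrite lexx (ltW xy).
rewrite [mobius x y]mobiusE lt_eqF // addrC; apply/eqP; rewrite subr_eq0.
by apply/eqP/eq_bigl => z; rewrite lt_neqAle -andbA [(z <= y)%O && _]andbC.
Qed.

Lemma mobius_nle (d : Order.disp_t) (T : finPOrderType d) (x y : T) :
  ~~ (x <= y)%O -> mobius x y = 0.
Proof.
move=> nxy; rewrite mobiusE; case: eqP nxy => [->|_ nxy]; first by rewrite lexx.
rewrite big_pred0 ?oppr0 // => z; apply/negP => /andP[xz /ltW zy].
by rewrite (le_trans xz zy) in nxy.
Qed.

(* The symbol [l] is [None : option V]; an element [v] of X is [Some v]. *)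
Definition lblock (V : finType) (b : bool) (B : {set V}) : {set option V} :=
  Some @: B :|: (if b then [set None] else set0).

Definition unlabel (V : finType) (A : {set option V}) : {set V} :=
  Some @^-1: A.

Definition is_lpart (V : finType) (X : {set V}) (pi : {set {set option V}}) :
    bool :=
  [exists P : {set {set V}}, exists L : {ffun {set V} -> bool},
    partition P X && (pi == [set lblock (L B) B | B in P])].

Record lpart (V : finType) (X : {set V}) := LPart {
  lblocks :> {set {set option V}};
  _ : is_lpart X lblocks
}.

HB.instance Definition _ (V : finType) (X : {set V}) :=
  [isSub for @lblocks V X].
HB.instance Definition _ (V : finType) (X : {set V}) :=
  [Finite of lpart X by <:].

Lemma in_unlabel (V : finType) (A : {set option V}) (x : V) :
  (x \in unlabel A) = (Some x \in A).
Proof. by rewrite inE. Qed.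

Lemma lblockK (V : finType) (b : bool) : cancel (@lblock V b) (@unlabel V).
Proof.
move=> B; apply/setP => x; rewrite in_unlabel inE (mem_imset _ _ Some_inj).
by case: b; rewrite inE orbF.
Qed.

Lemma None_lblock (V : finType) (b : bool) (B : {set V}) :
  (None \in lblock b B) = b.
Proof.
rewrite inE; case: imsetP => [[] //|_].
by case: b; rewrite !inE.
Qed.

Lemma unlabelK (V : finType) (A : {set option V}) :
  lblock (None \in A) (unlabel A) = A.
Proof.
apply/setP => -[x|]; last by rewrite None_lblock.
by rewrite -in_unlabel lblockK in_unlabel.
Qed.

Lemma is_lpartP (V : finType) (X : {set V}) (pi : {set {set option V}}) :
  reflect [/\ forall A, A \in pi -> exists x, Some x \in A,
              forall A x, A \in pi -> Some x \in A -> x \in X,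
              forall x, x \in X -> exists2 A, A \in pi & Some x \in A
            & forall A B x, A \in pi -> B \in pi ->
                Some x \in A -> Some x \in B -> A = B]
          (is_lpart X pi).
Proof.
apply: (iffP existsP).
  move=> [P /existsP[L /andP[/and3P[/eqP covP trP P0] /eqP ->]]]; split.
  - move=> _ /imsetP[B BP ->].
    have /set0Pn[x xB] : B != set0 by apply: contraNneq P0 => <-.
    by exists x; rewrite -in_unlabel lblockK.
  - move=> _ x /imsetP[B BP ->]; rewrite -in_unlabel lblockK => xB.
    by rewrite -covP; apply/bigcupP; exists B.
  - move=> x; rewrite -covP => /bigcupP[B BP xB].
    exists (lblock (L B) B); last by rewrite -in_unlabel lblockK.
    exact: imset_f.
  - move=> _ _ x /imsetP[B BP ->] /imsetP[C CP ->].
    rewrite -!in_unlabel !lblockK => xB xC.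
    by rewrite -(def_pblock trP BP xB) -(def_pblock trP CP xC).
move=> [ne sX cX dj].
exists [set unlabel A | A in pi]; apply/existsP.
exists [ffun B => lblock true B \in pi].
have LE A : A \in pi ->
    lblock ([ffun B => lblock true B \in pi] (unlabel A)) (unlabel A) = A.
  move=> Api; rewrite ffunE -[RHS]unlabelK; congr (lblock _ _).
  have [x xA] := ne _ Api; apply/idP/idP => [tpi|NA].
    rewrite (dj A _ x Api tpi xA) ?None_lblock //.
    by rewrite -in_unlabel lblockK in_unlabel.
  by rewrite -[true]NA unlabelK.
apply/andP; split; last first.
  rewrite -imset_comp; apply/eqP; rewrite -[LHS]imset_id.
  by apply: eq_in_imset => A Api /=; rewrite LE.
apply/and3P; split.
- apply/eqP/setP => x; apply/bigcupP/idP.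
    by move=> [_ /imsetP[A Api ->]]; rewrite in_unlabel => /(sX _ _ Api).
  move=> /cX[A Api xA]; exists (unlabel A); last by rewrite in_unlabel.
  exact: imset_f.
- apply/trivIsetP => _ _ /imsetP[A Api ->] /imsetP[B Bpi ->] neAB.
  rewrite disjoint_subset; apply/subsetP => x; rewrite in_unlabel => xA.
  rewrite inE /= in_unlabel; apply: contra neAB => xB.
  by rewrite (dj _ _ _ Api Bpi xA xB).
- apply/imsetP => -[A Api /setP e0]; have [x] := ne _ Api.
  by rewrite -in_unlabel -e0 inE.
Qed.

Lemma lpartP (V : finType) (X : {set V}) (pi : lpart X) : is_lpart X pi.
Proof. exact: valP. Qed.

Definition lpart_le (V : finType) (X : {set V}) (sigma pi : lpart X) : bool :=
  [forall A in lblocks sigma, exists B in lblocks pi, A \subset B].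

Lemma lpart_leP (V : finType) (X : {set V}) (sigma pi : lpart X) :
  reflect (forall A, A \in lblocks sigma ->
             exists2 B, B \in lblocks pi & A \subset B)
          (lpart_le sigma pi).
Proof.
apply: (iffP forall_inP) => h A /h; first by move/exists_inP.
by move=> h'; apply/exists_inP.
Qed.

Lemma lpart_le_refl (V : finType) (X : {set V}) : reflexive (@lpart_le V X).
Proof. by move=> pi; apply/lpart_leP => A Api; exists A. Qed.

Lemma lpart_le_trans (V : finType) (X : {set V}) : transitive (@lpart_le V X).
Proof.
move=> r p q /lpart_leP h1 /lpart_leP h2; apply/lpart_leP => A /h1[B /h2[C Cq BC]].
by move=> AB; exists C => //; apply: subset_trans BC.
Qed.

Lemma lpart_le_anti (V : finType) (X : {set V}) :
  antisymmetric (@lpart_le V X).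
Proof.
have half (p q : lpart X) : lpart_le p q -> lpart_le q p ->
    lblocks p \subset lblocks q.
  move=> /lpart_leP pq /lpart_leP qp; apply/subsetP => A Ap.
  have [B Bq AB] := pq _ Ap; have [C Cp BC] := qp _ Bq.
  have /is_lpartP[ne _ _ dj] := lpartP p.
  have [x xA] := ne _ Ap.
  have AC : A = C.
    by apply: (dj _ _ x) => //; apply: (subsetP BC); apply: (subsetP AB).
  suff -> : A = B by [].
  by apply/eqP; rewrite eqEsubset AB AC BC.
move=> p q /andP[pq qp]; apply: val_inj; apply/eqP.
by rewrite eqEsubset !half.
Qed.

Fact lpart_display : Order.disp_t. Proof. exact: Order.Disp tt tt. Qed.

HB.instance Definition _ (V : finType) (X : {set V}) :=
  Order.Le_isPOrder.Build lpart_display (lpart X)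
    (@lpart_le_refl V X) (@lpart_le_anti V X) (@lpart_le_trans V X).

(* Infimum of a set of labelled partitions: the block of [x] is the
   intersection of the blocks of [x] in the members of [S]. *)
Definition linf_block (V : finType) (X : {set V}) (S : {set lpart X}) (x : V) :
    {set option V} :=
  lblock true X :&: \bigcap_(tau in S) pblock (lblocks tau) (Some x).

Lemma lpart_pblock (V : finType) (X : {set V}) (tau : lpart X) (x : V)
    (xX : x \in X) :
  (pblock (lblocks tau) (Some x) \in lblocks tau) *
  (Some x \in pblock (lblocks tau) (Some x)).
Proof.
have /is_lpartP[_ _ cX _] := lpartP tau; have [A At xA] := cX _ xX.
have xc : Some x \in cover tau by apply/bigcupP; exists A.
by rewrite pblock_mem // mem_pblock.
Qed.

Lemma lpart_block_eq (V : finType) (X : {set V}) (tau : lpart X)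
    (A : {set option V}) (x : V) (At : A \in lblocks tau) (xA : Some x \in A) :
  pblock (lblocks tau) (Some x) = A.
Proof.
have /is_lpartP[_ sX _ dj] := lpartP tau.
have [h1 h2] := lpart_pblock tau (sX _ _ At xA).
exact: dj h2 xA.
Qed.

Lemma in_linf_block (V : finType) (X : {set V}) (S : {set lpart X})
    (x y : V) (xX : x \in X) :
  Some y \in linf_block S x -> y \in X /\ linf_block S y = linf_block S x.
Proof.
rewrite inE -in_unlabel lblockK => /andP[yX /bigcapP h]; split=> //.
congr (_ :&: _); apply: eq_bigr => tau tS; apply: lpart_block_eq (h _ tS).
by rewrite lpart_pblock.
Qed.

Lemma linf_block_refl (V : finType) (X : {set V}) (S : {set lpart X})
    (x : V) (xX : x \in X) : Some x \in linf_block S x.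
Proof.
rewrite inE -in_unlabel lblockK xX /=; apply/bigcapP => tau _.
by rewrite lpart_pblock.
Qed.

Lemma linf_is_lpart (V : finType) (X : {set V}) (S : {set lpart X}) :
  is_lpart X [set linf_block S x | x in X].
Proof.
apply/is_lpartP; split.
- by move=> _ /imsetP[x xX ->]; exists x; apply: linf_block_refl.
- by move=> _ y /imsetP[x xX ->] /(in_linf_block xX)[].
- by move=> x xX; exists (linf_block S x); rewrite ?imset_f ?linf_block_refl.
- move=> _ _ z /imsetP[x xX ->] /imsetP[y yX ->].
  by move=> /(in_linf_block xX)[_ <-] /(in_linf_block yX)[].
Qed.

Definition linf (V : finType) (X : {set V}) (S : {set lpart X}) : lpart X :=
  LPart (linf_is_lpart S).

Lemma le_linf (V : finType) (X : {set V}) (S : {set lpart X}) (rho : lpart X) :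
  reflect (forall tau, tau \in S -> (rho <= tau)%O) (rho <= linf S)%O.
Proof.
apply: (iffP idP) => [le_rho tau tS | h].
  apply: le_trans le_rho _; apply/lpart_leP => _ /imsetP[x xX ->].
  exists (pblock (lblocks tau) (Some x)); first by rewrite lpart_pblock.
  by apply: subset_trans (subsetIr _ _) _; apply: bigcap_inf.
apply/lpart_leP => A Ar; have /is_lpartP[ne sX _ _] := lpartP rho.
have [x xA] := ne _ Ar; have xX := sX _ _ Ar xA.
exists (linf_block S x); first exact: imset_f.
rewrite subsetI; apply/andP; split.
  apply/subsetP => -[y yA|_]; last by rewrite None_lblock.
  by rewrite -in_unlabel lblockK (sX _ _ Ar yA).
apply/bigcapsP => tau tS.
have /lpart_leP/(_ _ Ar)[B Bt AB] := h _ tS.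
by rewrite (lpart_block_eq Bt (subsetP AB _ xA)).
Qed.

Lemma lpart_lexI (V : finType) (X : {set V}) (x y z : lpart X) :
  (x <= linf [set y; z])%O = (x <= y)%O && (x <= z)%O.
Proof.
apply/le_linf/andP => [h|[xy xz] tau]; first by rewrite !h ?set21 ?set22.
by move=> /set2P[] ->.
Qed.

Lemma lpart_leUx (V : finType) (X : {set V}) (x y z : lpart X) :
  (linf [set t | (x <= t)%O && (y <= t)%O] <= z)%O = (x <= z)%O && (y <= z)%O.
Proof.
apply/idP/andP => [h|[xz yz]].
  by split; apply: le_trans h; apply/le_linf => t; rewrite inE => /andP[].
by move: (lexx (linf [set t | (x <= t)%O && (y <= t)%O])) => /le_linf; apply;
  rewrite inE xz yz.
Qed.

HB.instance Definition _ (V : finType) (X : {set V}) :=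
  @Order.POrder_MeetJoin_isLattice.Build lpart_display (lpart X)
    (fun x y => linf [set x; y])
    (fun x y => linf [set t | (x <= t)%O && (y <= t)%O])
    (@lpart_lexI V X) (@lpart_leUx V X).

Definition blocks (V : finType) (X : {set V}) (pi : lpart X) : {set {set V}} :=
  [set unlabel A | A in lblocks pi].

Definition nlabelled (V : finType) (X : {set V}) (pi : lpart X) : nat :=
  #|[set A in lblocks pi | None \in A]|.

Definition mlab (V : finType) (X : {set V}) (pi : lpart X) : nat :=
  nlabelled pi == 1%N.

Lemma lsingles_is_lpart (V : finType) (K X : {set V}) :
  is_lpart X [set lblock (x \in K) [set x] | x in X].
Proof.
have inE' x y b : (Some y \in lblock b [set x]) = (y == x).
  by rewrite -in_unlabel lblockK inE.
apply/is_lpartP; split.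
- by move=> _ /imsetP[x xX ->]; exists x; rewrite inE'.
- by move=> _ y /imsetP[x xX ->]; rewrite inE' => /eqP ->.
- move=> x xX; exists (lblock (x \in K) [set x]); last by rewrite inE'.
  exact: (imset_f (fun x => lblock (x \in K) [set x])).
- move=> _ _ z /imsetP[x xX ->] /imsetP[y yX ->].
  by rewrite !inE' => /eqP <- /eqP <-.
Qed.

Definition lsingles (V : finType) (K X : {set V}) : lpart X :=
  LPart (lsingles_is_lpart K X).

(* Pi_l(X, pi_X), where pi_X is [lsingles K X]; in [lambda] the Möbius function
   is that of the whole lattice Pi_l(X). *)
Definition Pil (V : finType) (K X : {set V}) : {set lpart X} :=
  [set pi : lpart X | (lsingles K X <= pi)%O && (0 < nlabelled pi)%N].

Definition lambda (V : finType) (K X : {set V}) (pi : lpart X) : int :=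
  \sum_(sigma in Pil K X | (pi <= sigma)%O) mobius pi sigma * (mlab sigma)%:R.

(* The vertices and edges of a graph form subsets of ambient types, so that
   subgraphs share these types with the whole graph.  Parallel edges are
   distinct [e] with equal [ends e], and [#|ends e| = 2] excludes loops; the
   value of [ends] outside [eset] is irrelevant. *)
Record mgraph (V E : finType) := MGraph {
  vset : {set V};
  eset : {set E};
  ends : E -> {set V};
  endsP : forall e, e \in eset -> ends e \subset vset /\ #|ends e| = 2%N
}.

Definition subgraph (V E : finType) (H G : mgraph V E) : Prop :=
  [/\ vset H \subset vset G, eset H \subset eset G
    & forall e, e \in eset H -> ends H e = ends G e].

Lemma spanning_endsP (V E : finType) (G : mgraph V E) (F : {set E}) :
  forall e, e \in eset G :&: F -> ends G e \subset vset G /\ #|ends G e| = 2%N.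
Proof. by move=> e /setIP[/endsP]. Qed.

(* Meant for [F \subset eset G]; the intersection makes it total. *)
Definition spanning (V E : finType) (G : mgraph V E) (F : {set E}) :
    mgraph V E :=
  MGraph (@spanning_endsP V E G F).

Definition adj (V E : finType) (H : mgraph V E) : rel V :=
  fun x y => [exists e in eset H, ends H e == [set x; y]].

Definition component (V E : finType) (H : mgraph V E) (v : V) : {set V} :=
  [set w in vset H | connect (adj H) v w].

Definition in_one_component (V E : finType) (H : mgraph V E)
    (K : {set V}) : bool :=
  [exists v in vset H, K \subset component H v].

Definition prob (R : realFieldType) (V E : finType) (G : mgraph V E)
    (p : E -> R) (F : {set E}) : R :=
  (\prod_(e in F) p e) * (\prod_(e in eset G :\: F) (1 - p e)).

Definition reliability (R : realFieldType) (V E : finType) (G : mgraph V E)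
    (p : E -> R) (K : {set V}) : R :=
  \sum_(F : {set E} | F \subset eset G)
    (in_one_component (spanning G F) K)%:R * prob G p F.

(* A vertex of the merged graph is [inr B] for a block [B], or [inl v] for a
   vertex [v] in no block. *)
Definition mergev (V : finType) (rho : {set {set V}}) (v : V) : V + {set V} :=
  if v \in cover rho then inr (pblock rho v) else inl v.

Definition merge_eset (V E : finType) (G : mgraph V E) (rho : {set {set V}}) :
    {set E} :=
  [set e in eset G | ~~ [exists B in rho, ends G e \subset B]].

Lemma merge_endsP (V E : finType) (G : mgraph V E) (rho : {set {set V}}) :
  forall e, e \in merge_eset G rho ->
    mergev rho @: ends G e \subset mergev rho @: vset G
    /\ #|mergev rho @: ends G e| = 2%N.
Proof.
move=> e; rewrite inE => /andP[/endsP[sV c2] nB]; split; first exact: imsetS.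
have /cards2P[x [y [nxy exy]]] : #|ends G e| == 2%N by rewrite c2.
rewrite exy imsetU1 imset_set1 cards2; case: eqP => // eqm; case/negP: nB.
move: eqm nxy; rewrite /mergev; case: ifP => [xc|_]; case: ifP => [yc|_] //.
  move=> [epb] _; apply/exists_inP; exists (pblock rho x).
    exact: pblock_mem.
  by rewrite exy subUset !sub1set {2}epb !mem_pblock xc yc.
by move=> [->]; rewrite eqxx.
Qed.

Definition merge_graph (V E : finType) (G : mgraph V E) (rho : {set {set V}}) :
    mgraph (V + {set V})%type E :=
  MGraph (@merge_endsP V E G rho).

(* K^i_pi; the argument [K] is K^i, the trace of the terminal set on V^i. *)
Definition mergeK (V : finType) (X : {set V}) (K : {set V}) (pi : lpart X) :
    {set V + {set V}} :=
  inl @: (K :\: X) :|: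
  inr @: [set unlabel A | A in lblocks pi
                        & (None \in A) || (unlabel A :&: K != set0)].

Record Ksplitting (V E : finType) (G : mgraph V E) (K : {set V})
    (G1 G2 : mgraph V E) (X : {set V}) : Prop := {
  split_sub1 : subgraph G1 G;
  split_sub2 : subgraph G2 G;
  split_eU : eset G1 :|: eset G2 = eset G;
  split_eI : eset G1 :&: eset G2 = set0;
  split_vU : vset G1 :|: vset G2 = vset G;
  split_vI : vset G1 :&: vset G2 = X;
  split_K1 : K :&: vset G1 != set0;
  split_K2 : K :&: vset G2 != set0
}.

(* [s] is the chosen ordering of Pi_l(X, pi_X). *)
Definition Mmx (R : realFieldType) (V : finType) (X : {set V}) (n : nat)
    (s : n.-tuple (lpart X)) : 'M[R]_n :=
  \matrix_(i, j) (mlab (tnth s i `|` tnth s j)%O)%:R.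

Definition rvec (R : realFieldType) (V E : finType) (X : {set V}) (n : nat)
    (s : n.-tuple (lpart X)) (Gi : mgraph V E) (p : E -> R) (K : {set V}) :
    'cV[R]_n :=
  \col_i reliability (merge_graph Gi (blocks (tnth s i))) p
                     (mergeK (K :&: vset Gi) (tnth s i)).

Definition idx0 (V : finType) (K X : {set V}) (n : nat)
    (s : n.-tuple (lpart X)) : {set 'I_n} :=
  [set i : 'I_n | lambda K (tnth s i) != 0].

(* Deletion of the rows (and columns) with index outside [I]; [enum_val]
   enumerates [I] increasingly. *)
Definition submx_at (R : realFieldType) (n : nat) (I : {set 'I_n})
    (A : 'M[R]_n) : 'M[R]_#|I| :=
  mxsub (fun i => enum_val i) (fun j => enum_val j) A.

Definition subcol_at (R : realFieldType) (n : nat) (I : {set 'I_n})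
    (v : 'cV[R]_n) : 'cV[R]_#|I| :=
  rowsub (fun i => enum_val i) v.

(* Main.v *)
(* Group the edge sets F1 of G1 and F2 of G2 by the labelled partitions pi1, pi2
   of X that they induce (blocks: traces of components; labelled: components
   containing a terminal).  If every terminal is joined to X on its own side,
   then K is connected in F1 u F2 iff pi1 v pi2 has exactly one labelled block,
   that is iff m (pi1 v pi2) = 1.  Merging along pi amounts to adding the
   relation "same block of pi" to the graph and the labelled elements of pi to
   the terminals, so the same glueing statement, with pi in place of the second
   graph, computes R(G^i_pi, K^i_pi).

   By Moebius inversion m (pi v sigma) is the sum of lambda tau over the common
   upper bounds tau; hence M0 = Z L Z^T with Z the (invertible) zeta matrix and
   L the diagonal matrix of the nonzero values of lambda.  With q_i tau the
   probability that the partition induced by G^i is valid and below tau, we get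
   r0 (G^i) = Z L q_i and R(G,K) = q_1^T L q_2. *)
Require Import Defs.
From mathcomp Require Import all_boot all_order all_algebra.

Set Implicit Arguments.
Unset Strict Implicit.
Unset Printing Implicit Defensive.

Import Order.TTheory GRing.Theory Num.Theory.
Local Open Scope ring_scope.

(** * Labelled partitions *)

Section LabelledPartitions.
Variables (V : finType) (X : {set V}).
Implicit Types (pi sigma tau : lpart X) (x y z : V) (b : option V).

(* [lrel tau x (Some y)]: [x] and [y] lie in the same block; [lrel tau x None]:
   the block of [x] is labelled. *)
Definition lrel tau x b := [exists A in lblocks tau, (Some x \in A) && (b \in A)].

Lemma lrelP tau x b :
  reflect (exists A, [/\ A \in lblocks tau, Some x \in A & b \in A])
          (lrel tau x b).
Proof.
apply: (iffP exists_inP) => [[A At /andP[xA bA]]|[A [At xA bA]]]; exists A => //.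
by rewrite xA.
Qed.

Lemma lrel_block tau A x b : A \in lblocks tau -> Some x \in A ->
  lrel tau x b = (b \in A).
Proof.
move=> At xA; apply/lrelP/idP => [[B [Bt xB bB]]|bA]; last by exists A.
by have /is_lpartP[_ _ _ dj] := lpartP tau; rewrite (dj A B x).
Qed.

Lemma lrel_mem tau x b : lrel tau x b -> x \in X.
Proof.
move=> /lrelP[A [At xA _]].
by have /is_lpartP[_ sX _ _] := lpartP tau; apply: sX At xA.
Qed.

Lemma mem_block tau x : x \in X -> exists2 A, A \in lblocks tau & Some x \in A.
Proof. by have /is_lpartP[_ _ cX _] := lpartP tau; apply: cX. Qed.

Lemma lrel_refl tau x : x \in X -> lrel tau x (Some x).
Proof. by move=> /(mem_block tau)[A At xA]; apply/lrelP; exists A. Qed.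

Lemma lrel_sym tau x y : lrel tau x (Some y) = lrel tau y (Some x).
Proof. by apply/lrelP/lrelP => -[A [At xA yA]]; exists A. Qed.

Lemma lrel_trans tau x y b :
  lrel tau x (Some y) -> lrel tau y b -> lrel tau x b.
Proof.
move=> /lrelP[A [At xA yA]]; rewrite (lrel_block _ At yA) => bA.
by rewrite (lrel_block _ At xA).
Qed.

(** Every block has an element of [X] as base point, so refinement is inclusion of relations; later
    arguments on the order avoid blocks altogether. *)
Lemma le_lrel sigma pi :
  reflect (forall x b, lrel sigma x b -> lrel pi x b) (sigma <= pi)%O.
Proof.
apply: (iffP (lpart_leP _ _)) => [h x b /lrelP[A [/h[B Bp AB] xA bA]]|h A As].
  by apply/lrelP; exists B; split=> //; apply: (subsetP AB).
have /is_lpartP[ne sX _ _] := lpartP sigma; have [x xA] := ne _ As.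
have [B Bp xB] := mem_block pi (sX _ _ As xA); exists B => //.
apply/subsetP => b bA; rewrite -(lrel_block _ Bp xB); apply: h.
by rewrite (lrel_block _ As xA).
Qed.

Lemma eq_lrel sigma pi : (forall x b, lrel sigma x b = lrel pi x b) -> sigma = pi.
Proof.
by move=> h; apply/eqP; rewrite eq_le; apply/andP; split;
  apply/le_lrel => x b; rewrite h.
Qed.

Lemma nlabelled_gt0 tau : (0 < nlabelled tau)%N = [exists x, lrel tau x None].
Proof.
rewrite /nlabelled card_gt0; apply/set0Pn/existsP => [[A]|[x /lrelP[A [At _ lA]]]].
  rewrite inE => /andP[At lA]; have /is_lpartP[ne _ _ _] := lpartP tau.
  by have [x xA] := ne _ At; exists x; apply/lrelP; exists A.
by exists A; rewrite inE At.
Qed.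

(** This restates [m] without counting, in a form that connectivity arguments can prove and use. *)
Lemma nlabelled_eq1 tau :
  reflect ((exists x, lrel tau x None) /\
           forall x y, lrel tau x None -> lrel tau y None -> lrel tau x (Some y))
          (nlabelled tau == 1%N).
Proof.
have /is_lpartP[ne _ _ dj] := lpartP tau.
apply: (iffP cards1P) => [[A eA]|[[x /lrelP[A [At xA lA]]] h]].
  have memA B : (B \in lblocks tau) && (None \in B) = (B == A).
    by move/setP/(_ B): eA; rewrite !inE.
  have /andP[At lA] : (A \in lblocks tau) && (None \in A) by rewrite memA.
  split; first by have [x xA] := ne _ At; exists x; apply/lrelP; exists A.
  move=> x y /lrelP[B [Bt xB lB]] /lrelP[C [Ct yC lC]].
  have /eqP eB : B == A by rewrite -memA Bt.
  have /eqP eC : C == A by rewrite -memA Ct.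
  by apply/lrelP; exists A; split; rewrite // -?eB // eB -eC.
exists A; apply/setP => B; rewrite !inE; apply/andP/eqP => [[Bt lB]|-> //].
have [y yB] := ne _ Bt.
have xy : lrel tau x (Some y).
  by apply: h; apply/lrelP; [exists A | exists B]; split.
by rewrite (lrel_block _ At xA) in xy; apply: (dj _ _ y).
Qed.

(** * Labelled partitions induced by connectivity *)

Section Connected.
Variables (e : rel V) (esym : symmetric e) (T : {set V}).

(** [T] may leave [X]: a terminal outside [X] labels the trace of its component. A component that
    misses [X] leaves no trace, which is why [meets_all] appears below. *)
Definition conn_blocks : {set {set option V}} :=
  [set lblock [exists t in T, connect e x t] [set y in X | connect e x y]
    | x in X].

Lemma conn_is_lpart : is_lpart X conn_blocks.
Proof.
have cs := sym_connect_sym esym.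
have mem c x y : (Some y \in lblock c [set y in X | connect e x y]) =
    (y \in X) && connect e x y.
  by rewrite -in_unlabel lblockK inE.
apply/is_lpartP; split.
- by move=> _ /imsetP[x xX ->]; exists x; rewrite mem xX connect0.
- by move=> _ y /imsetP[x xX ->]; rewrite mem => /andP[].
- move=> x xX; exists (lblock [exists t in T, connect e x t]
      [set y in X | connect e x y]); last by rewrite mem xX connect0.
  by apply/imsetP; exists x.
- move=> _ _ z /imsetP[x xX ->] /imsetP[y yX ->].
  rewrite !mem => /andP[zX xz] /andP[_ yz].
  have exy : connect e x =1 connect e y.
    by apply: (same_connect cs); rewrite (connect_trans xz) // cs.
  congr lblock; first by apply: eq_existsb => t; rewrite exy.
  by apply/setP => t; rewrite !inE exy.
Qed.

Definition conn_lpart : lpart X := LPart conn_is_lpart.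

Lemma lrel_connS x y :
  lrel conn_lpart x (Some y) = [&& x \in X, y \in X & connect e x y].
Proof.
case xX: (x \in X); last by apply/negbTE/(contraFN _ xX) => /lrel_mem.
rewrite /=.
have Bx : lblock [exists t in T, connect e x t] [set y in X | connect e x y]
    \in lblocks conn_lpart by apply/imsetP; exists x.
by rewrite (lrel_block _ Bx) -in_unlabel lblockK !inE ?xX ?connect0.
Qed.

Lemma lrel_connN x :
  lrel conn_lpart x None = (x \in X) && [exists t in T, connect e x t].
Proof.
case xX: (x \in X); last by apply/negbTE/(contraFN _ xX) => /lrel_mem.
rewrite /=.
have Bx : lblock [exists t in T, connect e x t] [set y in X | connect e x y]
    \in lblocks conn_lpart by apply/imsetP; exists x.
by rewrite (lrel_block _ Bx) ?None_lblock // -in_unlabel lblockK !inE xX connect0.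
Qed.

End Connected.

Definition same tau : rel V := fun x y => lrel tau x (Some y).
Definition labelled tau : {set V} := [set x | lrel tau x None].

Lemma same_sym tau : symmetric (same tau).
Proof. by move=> x y; apply: lrel_sym. Qed.

(** By transitivity a path collapses to one step; the equality covers vertices outside [X], where
    [same tau] is not reflexive. *)
Lemma connect_same tau x y : connect (same tau) x y = (x == y) || same tau x y.
Proof.
apply/idP/orP => [/connectP[p]|[/eqP-> //|/connect1 //]].
elim: p x => [|z p IHp] x /= => [_ ->|/andP[xz /IHp{}IHp] /IHp]; first by left.
by case=> [/eqP<-|zy]; right => //; apply: lrel_trans xz zy.
Qed.

(** Hence a labelled partition can itself play the part of one side of a glueing. *)
Lemma conn_same tau : conn_lpart (same_sym tau) (labelled tau) = tau.
Proof.
apply: eq_lrel => x [y|].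
  rewrite lrel_connS connect_same; apply/and3P/idP => [[xX yX /orP[/eqP<-|//]]|xy].
    exact: lrel_refl.
  rewrite (lrel_mem xy) /same xy orbT; split=> //.
  by move: xy; rewrite lrel_sym => /lrel_mem.
rewrite lrel_connN; apply/andP/idP => [[xX /exists_inP[t]]|lx].
  by rewrite inE connect_same => lt /orP[/eqP->|xt] //; apply: lrel_trans xt lt.
by rewrite (lrel_mem lx); split=> //; apply/exists_inP; exists x; rewrite ?inE.
Qed.

Lemma symmetric_relU (e1 e2 : rel V) :
  symmetric e1 -> symmetric e2 -> symmetric (relU e1 e2).
Proof. by move=> s1 s2 x y; rewrite /= s1 s2. Qed.

(** The right-hand side is an upper bound since it contains both relations and both sets of labels.
    It is the least one since any upper bound is transitive and so absorbs whole paths. *)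
Lemma join_conn pi sigma :
  (pi `|` sigma)%O = conn_lpart (symmetric_relU (same_sym pi) (same_sym sigma))
                               (labelled pi :|: labelled sigma).
Proof.
set tau := conn_lpart _ _.
have le1 rho : (forall x y, same rho x y -> relU (same pi) (same sigma) x y) ->
    (forall x, x \in labelled rho -> x \in labelled pi :|: labelled sigma) ->
    (rho <= tau)%O.
  move=> h1 h2; apply/le_lrel => x [y|] xy.
    rewrite lrel_connS; apply/and3P; split; last exact/connect1/h1.
      exact: lrel_mem xy.
    by move: xy; rewrite lrel_sym => /lrel_mem.
  rewrite lrel_connN (lrel_mem xy); apply/exists_inP; exists x => //.
  by apply: h2; rewrite inE.
apply/eqP; rewrite eq_le leUx; apply/andP; split; last first.
  have hu x b : lrel pi x b || lrel sigma x b -> lrel (pi `|` sigma)%O x b.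
    by case/orP; apply/le_lrel; rewrite ?leUl ?leUr.
  have hc x y : x \in X -> connect (relU (same pi) (same sigma)) x y ->
      lrel (pi `|` sigma)%O x (Some y).
    move=> xX /connectP[p]; elim/last_ind: p y => [y _ ->|p z IHp y].
      exact: lrel_refl.
    rewrite rcons_path last_rcons => /andP[/IHp/(_ erefl)xz zy] ->.
    exact: lrel_trans xz (hu _ _ zy).
  apply/le_lrel => x [y|]; first by rewrite lrel_connS => /and3P[xX _ /hc]; apply.
  rewrite lrel_connN => /andP[xX /exists_inP[t lt /(hc _ _ xX) xt]].
  by apply: lrel_trans xt (hu _ _ _); rewrite !inE in lt.
apply/andP; split; apply: le1 => [x y|x].
- by move=> /= ->.
- by rewrite in_setU => ->.
- by move=> /= ->; rewrite orbT.
- by rewrite in_setU => ->; rewrite orbT.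
Qed.

(** The blocks of [lsingles K X] are singletons, so lying above it constrains only the labels, at
    the terminals in [X]. *)
Lemma in_Pil (K : {set V}) pi :
  reflect ((forall x, x \in X -> x \in K -> x \in labelled pi) /\
           exists x, x \in labelled pi)
          (pi \in Pil K X).
Proof.
have bX x : x \in X -> lblock (x \in K) [set x] \in lblocks (lsingles K X).
  by move=> xX; apply/imsetP; exists x.
have xb x : Some x \in lblock (x \in K) [set x].
  by rewrite -in_unlabel lblockK inE.
rewrite inE nlabelled_gt0.
have ex : reflect (exists x, x \in labelled pi) [exists x, lrel pi x None].
  by apply: (iffP existsP) => -[x]; exists x; rewrite inE in p *.
apply: (iffP andP) => -[h1 h2]; split; try exact/ex.
  move=> x xX xK; rewrite inE; apply: (elimT (le_lrel _ _) h1).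
  by rewrite (lrel_block _ (bX _ xX)) ?None_lblock.
apply/le_lrel => x b xb'; have xX := lrel_mem xb'.
move: xb'; rewrite (lrel_block _ (bX _ xX)) //; case: b => [y|].
  by rewrite -in_unlabel lblockK inE => /eqP->; apply: lrel_refl.
by rewrite None_lblock => /(h1 _ xX); rewrite inE.
Qed.

End LabelledPartitions.

(** * Glueing *)

Section Glueing.
Variable V : finType.
Implicit Types (e : rel V) (T X : {set V}).

(** Stated for relations instead of graphs, so that [same pi] can stand in for the adjacency of a
    second graph. *)
Definition connected_set e T :=
  [forall x in T, forall y in T, connect e x y].

Lemma connected_setP e T :
  reflect {in T &, forall x y, connect e x y} (connected_set e T).
Proof.
apply: (iffP forall_inP) => [h x y /h/forall_inP|h x xT]; first exact.
by apply/forall_inP => y; apply: h.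
Qed.

Definition meets_all X e T := [forall t in T, exists x in X, connect e t x].

Lemma meets_allP X e T :
  reflect (forall t, t \in T -> exists2 x, x \in X & connect e t x)
          (meets_all X e T).
Proof. by apply: (iffP forall_inP) => h t /h => [/exists_inP|?]; [|apply/exists_inP]. Qed.

Lemma eq_connected_set T e1 e2 :
  e1 =2 e2 -> connected_set e1 T = connected_set e2 T.
Proof.
move=> /eq_connect e12; apply: eq_forallb => x; congr (_ ==> _).
by apply: eq_forallb => y; rewrite e12.
Qed.

Lemma connect_mem e T x y : (forall u v, e u v -> v \in T) -> x \in T ->
  connect e x y -> y \in T.
Proof.
move=> eT xT /connectP[p]; elim/last_ind: p y => [y _ ->//|p z _ y].
by rewrite rcons_path last_rcons => /andP[_ /eT zT] ->.
Qed.

Section TwoSides.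
Variables (V1 V2 X T1 T2 : {set V}) (e1 e2 : rel V).
Hypotheses (VX : V1 :&: V2 = X) (s1 : symmetric e1).
Hypotheses (e1V : forall x y, e1 x y -> x \in V1)
           (e2V : forall x y, e2 x y -> x \in V2).
Hypotheses (T1V : T1 \subset V1) (T2V : T2 \subset V2).

Let e1V' x y : e1 x y -> y \in V1. Proof. by rewrite s1 => /e1V. Qed.

(** If the [e1]-component of a terminal [t] misses [X], no step of [e2] starts in it, because its
    source would lie in both [V1] and [V2]. The component then does not grow in the union, yet it
    contains a terminal of [T2], which puts that terminal in [X]. *)
Lemma connected_meets : T2 != set0 ->
  connected_set (relU e1 e2) (T1 :|: T2) -> meets_all X e1 T1.
Proof.
move=> /set0Pn[t2 t2T] /connected_setP h; apply/meets_allP => t tT.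
have tV1 : t \in V1 by apply: (subsetP T1V).
have inX v : connect e1 t v -> v \in V2 -> v \in X.
  by move=> tv vV2; rewrite -VX inE vV2 (connect_mem e1V' tV1 tv).
have [/exists_inP//|nX] := boolP [exists x in X, connect e1 t x].
suff hc v : connect (relU e1 e2) t v -> connect e1 t v.
  have c2 : connect e1 t t2 by apply/hc/h; rewrite inE ?tT ?t2T ?orbT.
  by exists t2 => //; apply: inX c2 (subsetP T2V _ t2T).
move=> /connectP[p]; elim/last_ind: p v => [v _ ->//|p z IHp v].
rewrite rcons_path last_rcons => /andP[/IHp/(_ erefl) tl /orP[lz|lz]] ->.
  exact: connect_trans tl (connect1 lz).
by case/negP: nX; apply/exists_inP; exists (last t p); rewrite ?inX ?(e2V lz).
Qed.

End TwoSides.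

Section Glue.
Variables (V1 V2 X T1 T2 : {set V}) (e1 e2 : rel V).
Hypotheses (VX : V1 :&: V2 = X) (s1 : symmetric e1) (s2 : symmetric e2).
Hypotheses (e1V : forall x y, e1 x y -> x \in V1)
           (e2V : forall x y, e2 x y -> x \in V2).
Hypotheses (T1V : T1 \subset V1) (T2V : T2 \subset V2).
Hypotheses (T1n : T1 != set0) (T2n : T2 != set0).

Let e1V' x y : e1 x y -> y \in V1. Proof. by rewrite s1 => /e1V. Qed.
Let e2V' x y : e2 x y -> y \in V2. Proof. by rewrite s2 => /e2V. Qed.
Let pi1 := conn_lpart X s1 T1.
Let pi2 := conn_lpart X s2 T2.
Let cs := sym_connect_sym (symmetric_relU s1 s2).
Let XV1 x : x \in X -> x \in V1. Proof. by rewrite -VX inE => /andP[]. Qed.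
Let XV2 x : x \in X -> x \in V2. Proof. by rewrite -VX inE => /andP[]. Qed.

Let sub1 x y : connect e1 x y -> connect (relU e1 e2) x y.
Proof. by apply: connect_sub => a b ab; apply: connect1; rewrite /= ab. Qed.

Let sub2 x y : connect e2 x y -> connect (relU e1 e2) x y.
Proof. by apply: connect_sub => a b ab; apply: connect1; rewrite /= ab orbT. Qed.

(* A path of [relU e1 e2] changes sides only at vertices of [X]; [z] is the
   last such vertex before [v]. *)
Let traverse x v : x \in X -> connect (relU e1 e2) x v ->
  exists z, [/\ z \in X, connect (relU (same pi1) (same pi2)) x z
    & connect e1 z v || connect e2 z v].
Proof.
move=> xX /connectP[p]; elim/last_ind: p v => [v _ ->|p w IHp v].
  by exists x; rewrite xX !connect0.
rewrite rcons_path last_rcons => /andP[/IHp/(_ erefl)[z [zX xz]]].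
move: (last x p) => u zu uw -> {v}.
have step : u \in X -> connect (relU (same pi1) (same pi2)) x u.
  move=> uX; apply: connect_trans xz (connect1 _); rewrite /= /same !lrel_connS.
  by rewrite zX uX.
case/orP: uw => uw; case/orP: zu => zu.
- by exists z; rewrite zX xz (connect_trans zu (connect1 uw)).
- have uX : u \in X.
    by rewrite -VX inE (e1V uw) (connect_mem e2V' (XV2 zX) zu).
  by exists u; rewrite uX step // connect1.
- have uX : u \in X.
    by rewrite -VX inE (e2V uw) (connect_mem e1V' (XV1 zX) zu).
  by exists u; rewrite uX step // (connect1 uw) orbT.
- by exists z; rewrite zX xz (connect_trans zu (connect1 uw)) orbT.
Qed.

(** When the endpoint is in [X] too, the last leg given by [traverse] is itself a step of [same pi1]
    or [same pi2]. *)
Let traverse_X x y : x \in X -> y \in X ->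
  connect (relU e1 e2) x y = connect (relU (same pi1) (same pi2)) x y.
Proof.
move=> xX yX; apply/idP/idP.
  move=> /(traverse xX)[z [zX xz zy]]; apply: connect_trans xz (connect1 _).
  by rewrite /= /same !lrel_connS zX yX.
apply: connect_sub => a b; rewrite /= /same !lrel_connS.
by case/orP=> /and3P[_ _]; [apply: sub1 | apply: sub2].
Qed.

Let labelledP x : x \in X ->
  reflect (exists2 t, t \in T1 & connect e1 x t) (x \in labelled pi1).
Proof. by move=> xX; rewrite inE lrel_connN xX; apply: exists_inP. Qed.

Let labelledP2 x : x \in X ->
  reflect (exists2 t, t \in T2 & connect e2 x t) (x \in labelled pi2).
Proof. by move=> xX; rewrite inE lrel_connN xX; apply: exists_inP. Qed.

Let labX x : x \in labelled pi1 :|: labelled pi2 -> x \in X.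
Proof. by rewrite !inE => /orP[] /lrel_mem. Qed.

(** A terminal labels the element of [X] that it reaches on its own side; [label_term] goes back
    from labels to terminals. *)
Let term_label t : meets_all X e1 T1 -> meets_all X e2 T2 -> t \in T1 :|: T2 ->
  exists x, [/\ x \in X, connect (relU e1 e2) t x
              & x \in labelled pi1 :|: labelled pi2].
Proof.
move=> /meets_allP m1 /meets_allP m2; rewrite inE => /orP[tT|tT].
  have [x xX tx] := m1 _ tT; exists x; split; rewrite ?sub1 // inE.
  by apply/orP; left; apply/labelledP => //; exists t; rewrite // (sym_connect_sym s1).
have [x xX tx] := m2 _ tT; exists x; split; rewrite ?sub2 // inE.
by apply/orP; right; apply/labelledP2 => //; exists t; rewrite // (sym_connect_sym s2).
Qed.

Let label_term x : x \in labelled pi1 :|: labelled pi2 ->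
  exists2 t, t \in T1 :|: T2 & connect (relU e1 e2) x t.
Proof.
move=> xl; have xX := labX xl; case/setUP: xl.
  by move=> /(labelledP xX)[t tT xt]; exists t; rewrite ?sub1 ?inE ?tT.
by move=> /(labelledP2 xX)[t tT xt]; exists t; rewrite ?sub2 ?inE ?tT ?orbT.
Qed.

(** Terminals and labelled elements of [X] are connected to each other, so all terminals are
    connected iff all labelled elements are. By [traverse_X] and [join_conn], connectivity inside
    [X] is lying in one block of the join. *)
Lemma connected_glue :
  connected_set (relU e1 e2) (T1 :|: T2) =
  [&& meets_all X e1 T1, meets_all X e2 T2
    & nlabelled (pi1 `|` pi2)%O == 1%N].
Proof.
have labE x : lrel (pi1 `|` pi2)%O x None ->
    exists t, [/\ x \in X, t \in labelled pi1 :|: labelled pi2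
                & connect (relU e1 e2) x t].
  rewrite join_conn lrel_connN => /andP[xX /exists_inP[t tl xt]].
  by exists t; split=> //; rewrite traverse_X //; apply: labX.
apply/idP/and3P => [h|[m1 m2 /nlabelled_eq1[_ h]]].
  have m1 : meets_all X e1 T1.
    exact: (connected_meets VX s1 e1V e2V T1V T2V T2n h).
  (* The same crossing argument with the two sides exchanged. *)
  have m2 : meets_all X e2 T2.
    have VX' : V2 :&: V1 = X by rewrite setIC.
    apply: (connected_meets VX' s2 e2V e1V T2V T1V T1n).
    rewrite setUC -(@eq_connected_set _ (relU e1 e2)) // => x y /=.
    exact: orbC.
  split=> //; apply/nlabelled_eq1; split.
    have /set0Pn[t tT] := T1n.
    have [x [xX tx xl]] : exists x, [/\ x \in X, connect (relU e1 e2) t x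
        & x \in labelled pi1 :|: labelled pi2].
      by apply: term_label; rewrite // inE tT.
    exists x; rewrite join_conn lrel_connN xX.
    by apply/exists_inP; exists x.
  move=> x y /labE[x' [xX /label_term[t tT xt] xx']].
  move=> /labE[y' [yX /label_term[u uT yu] yy']].
  rewrite join_conn lrel_connS xX yX -traverse_X //=.
  apply: connect_trans xx' (connect_trans xt _).
  apply: connect_trans (connected_setP _ _ h t u tT uT) _.
  by rewrite cs; apply: connect_trans yy' yu.
apply/connected_setP => t u tT uT.
have [x [xX tx xl]] := term_label m1 m2 tT.
have [y [yX uy yl]] := term_label m1 m2 uT.
have lab z : z \in labelled pi1 :|: labelled pi2 -> lrel (pi1 `|` pi2)%O z None.
  move=> zl; rewrite join_conn lrel_connN labX //.
  by apply/exists_inP; exists z.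
have := h x y (lab _ xl) (lab _ yl).
rewrite join_conn lrel_connS xX yX -traverse_X //= => xy.
by apply: connect_trans tx (connect_trans xy _); rewrite cs.
Qed.

End Glue.
End Glueing.

(** * Graphs and merging *)

Section Graphs.
Variables (V E : finType).
Implicit Types (G H : mgraph V E) (F : {set E}) (K : {set V}).

Lemma adj_sym H : symmetric (adj H).
Proof. by move=> x y; apply: eq_existsb => e; rewrite setUC. Qed.

Lemma adj_vset H x y : adj H x y -> x \in vset H.
Proof.
move=> /exists_inP[e /endsP[/subsetP sV _] /eqP exy].
by apply: sV; rewrite exy set21.
Qed.

Lemma in_one_componentE H K : K \subset vset H -> K != set0 ->
  in_one_component H K = connected_set (adj H) K.
Proof.
move=> KV /set0Pn[k kK]; have cs := sym_connect_sym (@adj_sym H).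
apply/exists_inP/connected_setP => [[v vV /subsetP h] x y xK yK|h].
  have /setIdP[_ vx] := h x xK; have /setIdP[_ vy] := h y yK.
  by apply: connect_trans vy; rewrite cs.
exists k; first exact: (subsetP KV).
by apply/subsetP => x xK; rewrite inE (subsetP KV) ?h.
Qed.

Lemma adj_spanningU G G1 G2 F :
  subgraph G1 G -> subgraph G2 G -> eset G1 :|: eset G2 = eset G ->
  adj (spanning G F) =2 relU (adj (spanning G1 F)) (adj (spanning G2 F)).
Proof.
move=> [_ _ E1] [_ _ E2] EU x y; apply/exists_inP/orP.
  move=> [e /setIP[]]; rewrite -EU => /setUP[] eG eF exy; [left|right];
    by apply/exists_inP; exists e; rewrite /= ?E1 ?E2 // inE eG.
case=> /exists_inP[e /setIP[eG eF]] /=; rewrite ?E1 ?E2 // => exy; exists e => //.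
  by rewrite /= -EU !inE eG eF.
by rewrite /= -EU !inE eG eF orbT.
Qed.

Lemma adj_spanningI G F1 F2 : eset G :&: F1 = eset G :&: F2 ->
  adj (spanning G F1) =2 adj (spanning G F2).
Proof. by move=> eF x y; apply: eq_existsb => e; rewrite /= eF. Qed.

End Graphs.

(** * Merging as the addition of a relation *)

Section Merge.
Variables (V E : finType) (X : {set V}) (pi : lpart X).
Implicit Types (G H : mgraph V E) (F : {set E}) (K : {set V}).

Lemma mergev_out x : x \notin X -> mergev (blocks pi) x = inl x.
Proof.
rewrite /mergev; case: ifP => // /bigcupP[_ /imsetP[A Ap ->]].
rewrite in_unlabel => xA; have /is_lpartP[_ sX _ _] := lpartP pi.
by rewrite (sX _ _ Ap xA).
Qed.

Lemma mergev_in x A : A \in lblocks pi -> Some x \in A ->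
  mergev (blocks pi) x = inr (unlabel A).
Proof.
move=> Ap xA; have /is_lpartP[_ _ _ dj] := lpartP pi.
have Ab : unlabel A \in blocks pi by apply: imset_f.
have xu : x \in unlabel A by rewrite in_unlabel.
rewrite /mergev ifT; last by apply/bigcupP; exists (unlabel A).
congr inr; apply: def_pblock => //.
apply/trivIsetP => _ _ /imsetP[B Bp ->] /imsetP[C Cp ->] neBC.
rewrite disjoint_subset; apply/subsetP => y; rewrite in_unlabel => yB.
rewrite inE /= in_unlabel; apply: contra neBC => yC.
by rewrite (dj _ _ _ Bp Cp yB yC).
Qed.

Lemma eq_mergev x y :
  (mergev (blocks pi) x == mergev (blocks pi) y) = (x == y) || same pi x y.
Proof.
apply/eqP/orP => [|[/eqP->//|/lrelP[A [Ap xA yA]]]]; last first.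
  by rewrite !(mergev_in Ap).
have [xX|xX] := boolP (x \in X); last rewrite (mergev_out xX).
  have [A Ap xA] := mem_block pi xX; rewrite (mergev_in Ap xA).
  have [yX|yX] := boolP (y \in X); last by rewrite (mergev_out yX).
  have [B Bp yB] := mem_block pi yX; rewrite (mergev_in Bp yB) => -[AB].
  right; apply/lrelP; exists A; split=> //.
  by rewrite -in_unlabel AB in_unlabel.
have [yX|yX] := boolP (y \in X); last by rewrite (mergev_out yX) => -[->]; left.
by have [B Bp yB] := mem_block pi yX; rewrite (mergev_in Bp yB).
Qed.

(** A merged edge lifts to an edge whose ends are the prescribed ones up to [same pi]. Conversely, a
    step between distinct merged vertices comes from an edge that the merging keeps. *)
Lemma connect_merge G F x y :
  connect (adj (spanning (merge_graph G (blocks pi)) F))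
    (mergev (blocks pi) x) (mergev (blocks pi) y) =
  connect (relU (adj (spanning G F)) (same pi)) x y.
Proof.
set f := mergev _; set e' := adj _; set e := relU _ _.
have fe a b : f a = f b -> connect e a b.
  move=> /eqP; rewrite eq_mergev => /orP[/eqP->//|ab].
  by apply: connect1; rewrite /e /= ab orbT.
apply/idP/idP => [|/connectP[p]].
  suff hc w : connect e' (f x) w -> exists2 z, w = f z & connect e x z.
    by move=> /hc[z /esym/fe zy xz]; apply: connect_trans xz zy.
  move=> /connectP[p]; elim/last_ind: p w => [w _ ->|p u IHp w]; first by exists x.
  rewrite rcons_path last_rcons => /andP[/IHp/(_ erefl)[z -> xz]].
  move=> /exists_inP[d /setIP[dG dF] /eqP /= dzw] -> {w}.
  have dG1 : d \in eset G by move: dG; rewrite inE => /andP[].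
  have [_ /eqP/cards2P[a [b [nab dab]]]] := endsP dG1.
  have ab : connect e a b.
    apply: connect1; apply/orP; left; apply/exists_inP; exists d.
      by rewrite inE dG1.
    by rewrite /= dab.
  have ba : connect e b a.
    apply: connect1; apply/orP; left; rewrite adj_sym.
    by apply/exists_inP; exists d; rewrite ?inE ?dG1 //= dab.
  have zd : f z \in f @: ends G d by rewrite dzw set21.
  have ud : u \in f @: ends G d by rewrite dzw set22.
  have : f @: ends G d = [set f a; f b] by rewrite dab imsetU1 imset_set1.
  move=> fd; rewrite fd in zd ud.
  (* Membership leaves four ways to match [z] and [u] with the ends [a] and [b]; when both match the
     same end, no edge has to be crossed. *)
  case/set2P: zd => /fe zd; case/set2P: ud => ->; have xd := connect_trans xz zd.
  - by exists a.
  - by exists b => //; apply: connect_trans xd ab.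
  - by exists a => //; apply: connect_trans xd ba.
  - by exists b.
elim: p x => [|z p IHp] x /= => [_ -> //|/andP[xz /IHp{}IHp] /IHp].
(* A step inside a block becomes the empty path. *)
apply: connect_trans; have [->//|nfz] := eqVneq (f x) (f z).
case/orP: xz => [/exists_inP[d /setIP[dG dF] /eqP /= dxz]|xz]; last first.
  by case/eqP: nfz; apply/eqP; rewrite eq_mergev xz orbT.
apply: connect1; apply/exists_inP; exists d; last first.
  by rewrite /= dxz imsetU1 imset_set1.
rewrite !inE dG dF andbT /=; apply: contra nfz => /exists_inP[B].
move=> /imsetP[A Ap ->]; rewrite dxz subUset !sub1set !in_unlabel => /andP[xA zA].
by rewrite /f !(mergev_in Ap).
Qed.

(** Labelled blocks are non-empty, hence images of labelled elements; so the merged terminals pull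
    back to [K :|: labelled pi] in the original graph. *)
Lemma mergeKE K : mergeK K pi = mergev (blocks pi) @: (K :|: labelled pi).
Proof.
apply/setP => w; apply/setUP/imsetP.
  case=> /imsetP[x].
    by rewrite inE => /andP[xX xK] ->; exists x; rewrite ?inE ?xK // mergev_out.
  move=> /imsetP[A] ; rewrite inE => /andP[Ap /orP[lA|/set0Pn[y yAK]]] -> ->.
    have /is_lpartP[ne _ _ _] := lpartP pi; have [y yA] := ne _ Ap.
    exists y; last by rewrite (mergev_in Ap).
    by rewrite !inE (lrel_block _ Ap yA) lA orbT.
  move: yAK; rewrite inE in_unlabel => /andP[yA yK].
  by exists y; rewrite ?inE ?yK // (mergev_in Ap).
move=> [x xKl ->]; have [xX|xX] := boolP (x \in X); last first.
  left; rewrite mergev_out //; apply/imset_f; rewrite inE xX.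
  by case/setUP: xKl => //; rewrite inE => /lrel_mem; rewrite (negPf xX).
right; have [A Ap xA] := mem_block pi xX; rewrite (mergev_in Ap xA).
apply/imset_f/imset_f; rewrite inE Ap /=; case/setUP: xKl => [xK|].
  by apply/orP; right; apply/set0Pn; exists x; rewrite inE in_unlabel xA.
by rewrite inE (lrel_block _ Ap xA) => ->.
Qed.

(** This is [connected_glue] with second side [same pi] on the vertex set [X] and terminals
    [labelled pi]. These terminals lie in [X], so [meets_all] is automatic there. *)
Lemma in_one_component_merge G F K : X \subset vset G -> K \subset vset G ->
  K != set0 -> labelled pi != set0 ->
  in_one_component (spanning (merge_graph G (blocks pi)) F) (mergeK K pi) =
  meets_all X (adj (spanning G F)) K &&
  (nlabelled (conn_lpart X (@adj_sym _ _ (spanning G F)) K `|` pi)%O == 1%N).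
Proof.
move=> XV KV Kn ln.
have lX : labelled pi \subset X.
  by apply/subsetP => x; rewrite inE => /lrel_mem.
rewrite in_one_componentE ?mergeKE; last 2 first.
- by apply: imsetS; rewrite subUset KV (subset_trans lX XV).
- by have /set0Pn[k kK] := Kn; apply/set0Pn; exists (mergev (blocks pi) k);
    rewrite imset_f // inE kK.
have VX : vset G :&: X = X by apply/setIidPr.
have aV x y : adj (spanning G F) x y -> x \in vset G by apply: adj_vset.
have sX x y : same pi x y -> x \in X by apply: lrel_mem.
have -> : meets_all X (adj (spanning G F)) K &&
    (nlabelled (conn_lpart X (@adj_sym _ _ (spanning G F)) K `|` pi)%O == 1%N) =
  connected_set (relU (adj (spanning G F)) (same pi)) (K :|: labelled pi).
  rewrite (connected_glue VX (@adj_sym _ _ _) (same_sym pi) aV sX KV lX Kn ln) conn_same.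
  congr (_ && _); rewrite andb_idl // => _; apply/meets_allP => t /(subsetP lX) tX.
  by exists t.
apply/connected_setP/connected_setP => [h x y xT yT|h].
  by rewrite -connect_merge h // imset_f.
by move=> _ _ /imsetP[x xT ->] /imsetP[y yT ->]; rewrite connect_merge h.
Qed.

End Merge.

(** * Product weights of edge sets *)

Section Weights.
Variables (R : realFieldType) (E : finType) (p : E -> R).
Implicit Types (A B F : {set E}).

(** This is [prob] with an explicit ambient edge set, so that it also applies to the edges that a
    merging deletes. *)
Definition weight A F : R := (\prod_(e in F) p e) * (\prod_(e in A :\: F) (1 - p e)).

Lemma weightU A B F1 F2 : [disjoint A & B] -> F1 \subset A -> F2 \subset B ->
  weight (A :|: B) (F1 :|: F2) = weight A F1 * weight B F2.
Proof.
move=> dAB sA sB.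
have dF : [disjoint F1 & F2] by apply: disjointWl sA (disjointWr sB dAB).
have dD : [disjoint A :\: F1 & B :\: F2].
  by apply: disjointWl (subsetDl _ _) (disjointWr (subsetDl _ _) dAB).
rewrite /weight; have -> : (A :|: B) :\: (F1 :|: F2) = (A :\: F1) :|: (B :\: F2).
  apply/setP => e; rewrite !inE.
  have := disjointFr dAB (x := e); have := subsetP sA e; have := subsetP sB e.
  case: (e \in A) (e \in B) (e \in F1) (e \in F2) => -[] [] [] //= h1 h2 h3;
    by [rewrite h3 | have := h1 isT | have := h2 isT].
have prodU (C D : {set E}) (f : E -> R) : [disjoint C & D] ->
    \prod_(e in C :|: D) f e = (\prod_(e in C) f e) * \prod_(e in D) f e.
  by move=> dCD; rewrite -bigU //; apply: eq_bigl => e; rewrite inE.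
by rewrite !prodU // mulrACA.
Qed.

(** Subsets of the union correspond to pairs through the traces on [A] and [B], and the weight is
    multiplicative. *)
Lemma sum_weightU A B (f : {set E} -> R) : [disjoint A & B] ->
  \sum_(F : {set E} | F \subset A :|: B) f F * weight (A :|: B) F =
  \sum_(F1 : {set E} | F1 \subset A) \sum_(F2 : {set E} | F2 \subset B)
    f (F1 :|: F2) * (weight A F1 * weight B F2).
Proof.
move=> dAB; rewrite pair_big /=.
rewrite (reindex_onto (fun F : {set E} * {set E} => F.1 :|: F.2)
  (fun F => (F :&: A, F :&: B))) /=; last first.
  by move=> F sF; rewrite -setIUr; apply/setIidPl.
apply: eq_big => [[F1 F2]|[F1 F2] /andP[_ /eqP[<- <-]]] /=; last first.
  by rewrite weightU ?subsetIr.
apply/andP/andP => [[_ /eqP[<- <-]]|[sA sB]]; first by rewrite !subsetIr.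
split; first exact: setUSS.
have dBA : [disjoint B & A] by rewrite disjoint_sym.
rewrite !setIUl (setIidPl sA) (setIidPl sB).
rewrite (disjoint_setI0 (disjointWl sB dBA)) (disjoint_setI0 (disjointWl sA dAB)).
by rewrite setU0 set0U.
Qed.

Lemma sum_weight A : \sum_(F : {set E} | F \subset A) weight A F = 1.
Proof.
(* Outside [A] the values 0 and 1 kill the sets not contained in [A] and leave the other products
   unchanged; expanding the product of [P e + Q e] then gives the sum. *)
pose P e := if e \in A then p e else 0.
pose Q e := if e \in A then 1 - p e else 1.
have <- : \prod_e (P e + Q e) = 1.
  by apply: big1 => e _; rewrite /P /Q; case: ifP; rewrite ?add0r // addrC subrK.
rewrite bigA_distr [RHS](bigID (fun F : {set E} => F \subset A)) /=.
rewrite [X in _ + X]big1 ?addr0 => [|F /subsetPn[e eF eA]]; last first.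
  by rewrite (bigD1 e) //= eF /P (negPf eA) mul0r.
apply: eq_bigr => F sF; rewrite /weight big_mkcond [X in _ * X]big_mkcond.
rewrite -big_split; apply: eq_bigr => e _ /=; rewrite inE /P /Q.
have := subsetP sF e; case: (e \in F) => [->//|_]; first by rewrite mulr1.
by rewrite mul1r.
Qed.

End Weights.

(** * Moebius inversion and the zeta matrix *)

(** The recursion makes the Möbius matrix a left inverse of the zeta matrix. For square matrices it
    is then also a right inverse, which is this dual identity. *)
Lemma mobius_suml (d : Order.disp_t) (T : finPOrderType d) (x y : T) :
  \sum_(z | (x <= z)%O) mobius z y = (x == y)%:R.
Proof.
pose Z : 'M[int]_#|T| := \matrix_(i, j) (enum_val i <= enum_val j)%O%:R.
pose M : 'M[int]_#|T| := \matrix_(i, j) mobius (enum_val i) (enum_val j).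
have sumT (F : T -> int) : \sum_(i < #|T|) F (enum_val i) = \sum_z F z.
  by rewrite -big_enum_val.
have MZ : M *m Z = 1%:M.
  apply/matrixP => i j; rewrite !mxE.
  under eq_bigr do rewrite !mxE.
  rewrite (sumT (fun z => mobius (enum_val i) z * (z <= enum_val j)%O%:R)).
  rewrite -(inj_eq enum_val_inj); move: (enum_val i) (enum_val j) => u v.
  rewrite (eq_bigr (fun z => if (u <= z <= v)%O then mobius u z else 0));
    last first.
    move=> z _; case: (boolP (u <= z)%O) => [_|/mobius_nle ->]; last by rewrite mul0r.
    by case: (z <= v)%O; rewrite ?mulr1 ?mulr0.
  rewrite -big_mkcond; have [->|nuv] := eqVneq u v.
    rewrite (big_pred1 v) ?mobius_refl // => z.
    by rewrite -eq_le eq_sym.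
  have [uv|nle] := boolP (u <= v)%O.
    by apply: mobius_sum; rewrite lt_neqAle nuv.
  by rewrite big_pred0 // => z; apply: contraNF nle => /andP[]; apply: le_trans.
have := mulmx1C MZ => /matrixP/(_ (enum_rank x) (enum_rank y)).
rewrite !mxE (inj_eq enum_rank_inj) => <-.
under [RHS]eq_bigr do rewrite !mxE !enum_rankK.
rewrite (sumT (fun z => (x <= z)%O%:R * mobius z y)) big_mkcond.
by apply: eq_bigr => z _; case: ifP; rewrite ?mul1r ?mul0r.
Qed.

(** On an up-set the Möbius function of the whole poset serves: everything above [x] is in [A], and
    after exchanging the sums [mobius_suml] leaves only [z = x]. *)
Lemma mobius_inversion (d : Order.disp_t) (T : finPOrderType d) (A : {set T})
    (g : T -> int) (x : T) :
  {in A, forall y z, (y <= z)%O -> z \in A} -> x \in A ->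
  \sum_(y in A | (x <= y)%O) \sum_(z in A | (y <= z)%O) mobius y z * g z = g x.
Proof.
move=> Aup xA.
transitivity (\sum_(y | (x <= y)%O) \sum_(z in A) mobius y z * g z).
  apply: eq_big => [y|y /andP[yA xy]].
    by rewrite andb_idl // => /(Aup _ xA).
  rewrite [RHS](bigID (fun z => (y <= z)%O)) /= [X in _ = _ + X]big1 ?addr0 //.
  by move=> z /andP[_ /mobius_nle->]; rewrite mul0r.
rewrite exchange_big (bigD1 x) //= -mulr_suml mobius_suml eqxx mul1r.
rewrite big1 ?addr0 // => z /andP[_ nzx].
by rewrite -mulr_suml mobius_suml eq_sym (negPf nzx) mul0r.
Qed.

(** The matrix is unitriangular along any linear extension. Instead of choosing one, a vector of the
    left kernel is shown to vanish by induction on the number of elements below [f j]. *)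
Lemma zeta_unitmx (F : fieldType) (d : Order.disp_t) (T : finPOrderType d)
    (m : nat) (f : 'I_m -> T) : injective f ->
  (\matrix_(i, j) (f i <= f j)%O%:R : 'M[F]_m) \in unitmx.
Proof.
move=> f_inj; rewrite -row_free_unit; apply: inj_row_free => v vZ.
suff v0 j : v 0 j = 0 by apply/rowP => j; rewrite v0 mxE.
have [k] := ubnP #|[set z | (z < f j)%O]|; elim: k j => // k IHk j; rewrite ltnS => cj.
move/rowP/(_ j): vZ; rewrite !mxE (bigD1 j) //= mxE lexx mulr1 big1 ?addr0 //.
move=> i nij; rewrite mxE; have [le_ij|_] := boolP (f i <= f j)%O; last by rewrite mulr0.
have lt_ij : (f i < f j)%O by rewrite lt_neqAle le_ij (inj_eq f_inj) nij.
rewrite IHk ?mul0r //; apply: leq_trans cj; apply/proper_card/properP; split.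
  by apply/subsetP => z; rewrite !inE => /lt_trans; apply.
by exists (f i); rewrite !inE ?lt_ij ?ltxx.
Qed.

(** * The matrix of [m] through [lambda] *)

Section Lattice.
Variables (V : finType) (K X : {set V}).

Lemma Pil_up : {in Pil K X, forall pi sigma, (pi <= sigma)%O -> sigma \in Pil K X}.
Proof.
move=> pi /in_Pil[h [x xl]] sigma /le_lrel le; apply/in_Pil.
have sub y : y \in labelled pi -> y \in labelled sigma by rewrite !inE => /le.
by split=> [y yX yK|]; [apply/sub/h | exists x; apply: sub].
Qed.

Lemma sum_lambda (pi : lpart X) : pi \in Pil K X ->
  \sum_(sigma in Pil K X | (pi <= sigma)%O) lambda K sigma = (mlab pi)%:R.
Proof.
exact: (@mobius_inversion _ (lpart X) (Pil K X) (fun s => (mlab s)%:R) pi Pil_up).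
Qed.

(** Common upper bounds are the elements above the join, so this is [sum_lambda] at the join.
    Indices with [lambda] zero contribute nothing, hence the sum over [idx0] only. *)
Lemma mlab_join (R : nzRingType) (n : nat) (s : n.-tuple (lpart X))
    (pi sigma : lpart X) :
  uniq s -> s =i Pil K X -> pi \in Pil K X ->
  \sum_(i in idx0 K s) ((lambda K (tnth s i))%:~R *
    ((pi <= tnth s i)%O%:R * (sigma <= tnth s i)%O%:R)) =
  (mlab (pi `|` sigma)%O)%:R :> R.
Proof.
move=> us ms piP.
have jP : (pi `|` sigma)%O \in Pil K X by apply: Pil_up piP _ (leUl _ _).
rewrite -(rmorph_nat (intmul (1 : R))) -sum_lambda // rmorph_sum /=.
rewrite (eq_bigl (fun t => (t \in tval s) && ((pi `|` sigma)%O <= t)%O)); last first.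
  by move=> t; rewrite -ms.
rewrite big_mkcondr -big_uniq //= big_tuple [LHS]big_mkcond.
apply: eq_bigr => i _; rewrite inE leUx.
have [->|_] := eqVneq (lambda K (tnth s i)) 0; first by rewrite mulr0z; case: ifP.
by case: (pi <= _)%O (sigma <= _)%O => -[]; rewrite ?mulr1 ?mul0r ?mulr0.
Qed.

End Lattice.

(** * Factorisation of the reliability *)

Definition induced (V E : finType) (X : {set V}) (H : mgraph V E) (T : {set V}) :
    lpart X :=
  conn_lpart X (@adj_sym V E H) T.

(** A terminal in [X] labels its own block, and a terminal that reaches [X] provides at least one
    label. *)
Lemma induced_Pil (V E : finType) (X K T : {set V}) (H : mgraph V E) :
  K :&: X \subset T -> T != set0 -> meets_all X (adj H) T ->
  induced X H T \in Pil K X.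
Proof.
move=> /subsetP KT /set0Pn[t tT] /meets_allP mt; apply/in_Pil.
have lab x t' : x \in X -> t' \in T -> connect (adj H) x t' ->
    x \in labelled (induced X H T).
  move=> xX tT' xt; rewrite inE lrel_connN xX; apply/exists_inP.
  by exists t'.
split=> [x xX xK|]; first by apply: (lab x x) => //; apply: KT; rewrite inE xK.
have [x xX tx] := mt _ tT; exists x; apply: (lab x t) => //.
by rewrite (sym_connect_sym (@adj_sym _ _ H)).
Qed.

(** The edges deleted by the merging do not influence connectivity, so they can be put back with
    total weight 1. All mergings then share one sum over the edge sets of [G]. *)
Lemma reliability_merge (R : realFieldType) (V E : finType) (X : {set V})
    (pi : lpart X) (G : mgraph V E) (p : E -> R) (T : {set V}) :
  X \subset vset G -> T \subset vset G -> T != set0 -> labelled pi != set0 ->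
  reliability (merge_graph G (blocks pi)) p (mergeK T pi) =
  \sum_(F : {set E} | F \subset eset G)
    ((meets_all X (adj (spanning G F)) T)%:R *
     (mlab (induced X (spanning G F) T `|` pi)%O)%:R) * weight p (eset G) F.
Proof.
move=> XV TV Tn ln; pose A := merge_eset G (blocks pi).
pose f F : R :=
  (in_one_component (spanning (merge_graph G (blocks pi)) F) (mergeK T pi))%:R.
have sA : A \subset eset G by apply/subsetP => e; rewrite inE => /andP[].
have AG : eset G = A :|: (eset G :\: A).
  by rewrite setDE setUIr setUCr setIT; apply/esym/setUidPr.
transitivity (\sum_(F : {set E} | F \subset eset G) f F * weight p (eset G) F);
    last first.
  apply: eq_bigr => F _; congr (_ * _).
  by rewrite /f in_one_component_merge // /mlab -natrM mulnb.
rewrite AG sum_weightU; last first.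
  by rewrite disjoint_sym disjoints_subset setDE subsetIr.
apply: eq_bigr => F sF.
have fF (F2 : {set E}) : F2 \subset eset G :\: A -> f (F :|: F2) = f F.
  move=> sF2; have T'n : mergeK T pi != set0.
    have /set0Pn[t tT] := Tn; apply/set0Pn; exists (mergev (blocks pi) t).
    by rewrite mergeKE imset_f // inE tT.
  have T'V : mergeK T pi \subset vset (merge_graph G (blocks pi)).
    rewrite mergeKE imsetS // subUset TV (subset_trans _ XV) //.
    by apply/subsetP => x; rewrite inE => /lrel_mem.
  rewrite /f !in_one_componentE //; congr (nat_of_bool _)%:R.
  have eFF : eset (merge_graph G (blocks pi)) :&: (F :|: F2) =
      eset (merge_graph G (blocks pi)) :&: F.
    rewrite setIUr; apply/setUidPl; apply/subsetP => e /setIP[eA /(subsetP sF2)].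
    by rewrite inE eA.
  exact/eq_connected_set/adj_spanningI.
under eq_bigr => F2 sF2 do rewrite fF //.
by rewrite -!mulr_sumr sum_weight mulr1.
Qed.

Theorem theorem7p3 (R : realFieldType) (V E : finType) (G : mgraph V E)
    (p : E -> R) (hp : forall e, e \in eset G -> 0 <= p e <= 1)
    (K : {set V}) (hKV : K \subset vset G) (hK : (2 <= #|K|)%N)
    (G1 G2 : mgraph V E) (X : {set V}) (hsplit : Ksplitting G K G1 G2 X)
    (n : nat) (s : n.-tuple (lpart X))
    (hs_uniq : uniq s) (hs_mem : s =i Pil K X) :
  let I0 := idx0 K s in
  let M0 := submx_at I0 (Mmx R s) in
  let r0 (Gi : mgraph V E) := subcol_at I0 (rvec s Gi p K) in
  M0 \in unitmx /\
  reliability G p K = ((r0 G1)^T *m invmx M0 *m r0 G2) 0 0.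
Proof.
move=> I0 M0 r0.
pose t (a : 'I_#|I0|) := tnth s (enum_val a).
have tP a : t a \in Pil K X by rewrite -hs_mem; apply: mem_tnth.
have t_inj : injective t.
  by move=> a b /(tuple_uniqP _ hs_uniq); apply: enum_val_inj.
have sumI0 pi sigma : pi \in Pil K X ->
    \sum_a ((lambda K (t a))%:~R * ((pi <= t a)%O%:R * (sigma <= t a)%O%:R)) =
    (mlab (pi `|` sigma)%O)%:R :> R.
  move=> piP; rewrite -(mlab_join R sigma hs_uniq hs_mem piP).
  by rewrite [RHS]big_enum_val.
pose Z : 'M[R]_#|I0| := \matrix_(a, b) (t a <= t b)%O%:R.
pose L : 'M[R]_#|I0| := diag_mx (\row_a (lambda K (t a))%:~R).
have ZU : Z \in unitmx := zeta_unitmx R t_inj.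
(* The deletion kept exactly the indices with nonzero [lambda], and integers embed in [R]. *)
have LU : L \in unitmx.
  rewrite unitmxE det_diag unitfE; apply/prodf_neq0 => a _; rewrite mxE.
  by rewrite intr_eq0; have := enum_valP a; rewrite inE.
have M0E : M0 = Z *m L *m Z^T.
  apply/matrixP => a b; rewrite !mxE -/(t a) -/(t b) -sumI0 //.
  by apply: eq_bigr => c _; rewrite mul_mx_diag !mxE mulrA [_ * (t a <= _)%O%:R]mulrC.
pose T (Gi : mgraph V E) := K :&: vset Gi.
(* Edge sets that cut a terminal off from [X] get weight 0: they never connect the terminals, and
   their induced partition may lack a label. *)
pose w (Gi : mgraph V E) F : R :=
  (meets_all X (adj (spanning Gi F)) (T Gi))%:R * weight p (eset Gi) F.
pose Q Gi F := induced X (spanning Gi F) (T Gi).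
pose q Gi : 'cV[R]_#|I0| := \col_a
  \sum_(F : {set E} | F \subset eset Gi) w Gi F * (Q Gi F <= t a)%O%:R.
have QP Gi F : X \subset vset Gi -> T Gi != set0 ->
    meets_all X (adj (spanning Gi F)) (T Gi) -> Q Gi F \in Pil K X.
  by move=> XV Tn; apply: induced_Pil => //; apply: setIS.
(* Each value of [mlab] is expanded over the common upper bounds [t c] of [Q Gi F] and [t b]: the
   condition on [t b] yields [Z], the one on [Q Gi F] yields [q]. *)
have r0E Gi : X \subset vset Gi -> T Gi != set0 -> r0 Gi = Z *m L *m q Gi.
  move=> XV Tn; apply/matrixP => b j; rewrite !mxE -/(t b).
  rewrite reliability_merge ?subsetIr //; last first.
    by have /in_Pil[_ [x xl]] := tP b; apply/set0Pn; exists x.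
  under [RHS]eq_bigr => c _ do rewrite mul_mx_diag !mxE mulr_sumr.
  rewrite exchange_big; apply: eq_bigr => F _ /=.
  under eq_bigr => c _ do rewrite mulrCA -mulrA.
  rewrite /w -mulr_sumr mulrAC -/(T Gi).
  case: (boolP (meets_all _ _ _)) => [m|_]; last by rewrite !mul0r.
  rewrite -sumI0; last exact: QP.
  rewrite -mulr_sumr mulrA; congr (_ * _); apply: eq_bigr => c _.
  by rewrite [X in _ * X]mulrC mulrA [X in X * _]mulrC.
have X1 : X \subset vset G1 by rewrite -(split_vI hsplit) subsetIl.
have X2 : X \subset vset G2 by rewrite -(split_vI hsplit) subsetIr.
have T1 := split_K1 hsplit; have T2 := split_K2 hsplit.
have M0U : M0 \in unitmx by rewrite M0E !unitmx_mul ZU LU unitmx_tr ZU.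
split=> //; rewrite !r0E //.
have -> : (Z *m L *m q G1)^T *m invmx M0 *m (Z *m L *m q G2) =
    (q G1)^T *m L *m q G2.
  (* With a factor [M0] exposed, its inverse cancels without being computed. *)
  have ZLq : Z *m L *m q G2 = M0 *m (invmx Z^T *m q G2).
    by rewrite M0E -!mulmxA (mulmxA Z^T) mulmxV ?unitmx_tr // mul1mx.
  rewrite ZLq mulmxA mulmxKV // !trmx_mul tr_diag_mx -!mulmxA.
  by rewrite (mulmxA Z^T) mulmxV ?unitmx_tr // mul1mx.
have dE : [disjoint eset G1 & eset G2].
  by rewrite -setI_eq0 (split_eI hsplit).
rewrite /reliability -(split_eU hsplit).
transitivity (\sum_(F : {set E} | F \subset eset G1 :|: eset G2)
    (in_one_component (spanning G F) K)%:R * weight p (eset G1 :|: eset G2) F).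
  by apply: eq_bigr => F _; rewrite /prob -(split_eU hsplit).
rewrite sum_weightU //.
transitivity (\sum_(F1 : {set E} | F1 \subset eset G1)
  \sum_(F2 : {set E} | F2 \subset eset G2)
    (mlab (Q G1 F1 `|` Q G2 F2)%O)%:R * (w G1 F1 * w G2 F2)).
  apply: eq_bigr => F1 s1; apply: eq_bigr => F2 s2.
  (* The edge sets are disjoint, so each side sees only its own part of [F1 :|: F2]. *)
  have e1 : eset G1 :&: (F1 :|: F2) = eset G1 :&: F1.
    rewrite setIUr; apply/setUidPl.
    rewrite (subset_trans (setIS _ s2)) // (split_eI hsplit); exact: sub0set.
  have e2 : eset G2 :&: (F1 :|: F2) = eset G2 :&: F2.
    rewrite setIUr; apply/setUidPr.
    rewrite (subset_trans (setIS _ s1)) // setIC (split_eI hsplit); exact: sub0set.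
  have KT : K = T G1 :|: T G2.
    by rewrite -setIUr (split_vU hsplit); apply/esym/setIidPl.
  have Kn : K != set0 by rewrite -card_gt0 (leq_trans _ hK).
  have a1 := adj_spanningI e1; have a2 := adj_spanningI e2.
  rewrite in_one_componentE //.
  have -> : connected_set (adj (spanning G (F1 :|: F2))) K =
      connected_set (relU (adj (spanning G1 F1)) (adj (spanning G2 F2)))
        (T G1 :|: T G2).
    rewrite -KT; apply: eq_connected_set => x y.
    rewrite (adj_spanningU _ (split_sub1 hsplit) (split_sub2 hsplit)
      (split_eU hsplit)) /=.
    by rewrite a1 a2.
  rewrite (connected_glue (split_vI hsplit)
    (@adj_sym _ _ (spanning G1 F1)) (@adj_sym _ _ (spanning G2 F2))
    (@adj_vset _ _ (spanning G1 F1)) (@adj_vset _ _ (spanning G2 F2))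
    (subsetIr K _) (subsetIr K _) T1 T2).
  rewrite -!mulnb !natrM /w /mlab.
  rewrite -[conn_lpart X _ (T G1)]/(Q G1 F1) -[conn_lpart X _ (T G2)]/(Q G2 F2).
  by rewrite [in RHS]mulrACA [RHS]mulrA; congr (_ * _); rewrite mulrA mulrC.
transitivity (\sum_(F1 : {set E} | F1 \subset eset G1)
  \sum_(F2 : {set E} | F2 \subset eset G2) \sum_a
    (lambda K (t a))%:~R * ((w G1 F1 * (Q G1 F1 <= t a)%O%:R) *
      (w G2 F2 * (Q G2 F2 <= t a)%O%:R))).
  apply: eq_bigr => F1 s1; apply: eq_bigr => F2 s2.
  (* If the weight vanishes, so do both sides; otherwise the terminals of [G1] reach [X] and the
     expansion [sumI0] applies to [Q G1 F1]. *)
  have [->|wn] := eqVneq (w G1 F1) 0.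
    by rewrite mul0r mulr0 big1 // => a _; rewrite !mul0r mulr0.
  have QPil : Q G1 F1 \in Pil K X.
    apply: QP => //; apply: contraNT wn => /negPf nm.
    by rewrite /w nm mul0r.
  rewrite -sumI0 // mulr_suml; apply: eq_bigr => a _.
  by rewrite -[LHS]mulrA; congr (_ * _); rewrite mulrC mulrACA.
(* With [a] outermost, the double sum over [F1] and [F2] factors into the entries at [a] of [q G1]
   and [q G2]. *)
under eq_bigr => F1 _ do rewrite exchange_big.
rewrite exchange_big mxE; apply: eq_bigr => a _.
rewrite mul_mx_diag !mxE [X in X * _]mulrC -mulrA big_distrlr mulr_sumr.
by apply: eq_bigr => F1 _; rewrite mulr_sumr.
Qed.
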